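(* Let $n\ge 2$, let $G=\mathbb{R}^n\setminus\{0\}$, let $x\in G$ and let $M>0$. The $j$-ball $B_j(x,M)$ of $G$ is strictly starlike with respect to $x$ if and only if $M\in\big(0,\log(1+\sqrt{2})\big]$.
   Context: For a domain $G\subsetneq\mathbb{R}^n$, $n\ge 2$, and $x\in G$ let $d(x)$ denote the Euclidean distance from $x$ to $\partial G$ (so $d(x)=|x|$ when $G=\mathbb{R}^n\setminus\{0\}$). The $j$-metric on $G$ is $$j_G(x,y)=\log\left(1+\frac{|x-y|}{\min\{d(x),d(y)\}}\right),\qquad x,y\in G.$$ For $x\in G$ and $M>0$ the $j$-ball is $B_j(x,M)=\{y\in G: j_G(x,y)<M\}$. A bounded domain $D\subset\mathbb{R}^n$ is called strictly starlike with respect to a point $x\in D$ if each ray from $x$ meets $\partial D$ at exactly one point. *)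

(* Defs.v *)
From HB Require Import structures.
From mathcomp Require Import all_boot all_order all_algebra.
From mathcomp Require Import all_classical all_reals all_analysis.
Set Implicit Arguments.
Unset Strict Implicit.
Unset Printing Implicit Defensive.
Import Order.TTheory GRing.Theory Num.Theory.
Import numFieldNormedType.Exports.
Local Open Scope classical_set_scope.
Local Open Scope ring_scope.

(* The norm of ['rV[R]_n] in the library is the sup norm, so the Euclidean one
   is defined here.  Both induce the same topology, hence the library's
   [open], [closure], [interior] and [connected] on ['rV[R]_n] have their usual
   meaning in R^n. *)
Definition enorm (R : realType) (n : nat) (v : 'rV[R]_n) : R :=
  Num.sqrt (\sum_(i < n) v ord0 i ^+ 2).

Definition boundary (T : topologicalType) (A : set T) : set T :=
  closure A `\` interior A.

(* [inf] is the real-valued infimum; the set is nonempty and bounded below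
   by 0 when [G] is a nonempty proper subset of R^n with n > 0. *)
Definition bdist (R : realType) (n : nat) (G : set 'rV[R]_n) (x : 'rV[R]_n)
  : R := inf [set enorm (x - z) | z in boundary G].

Definition jmetric (R : realType) (n : nat) (G : set 'rV[R]_n)
    (x y : 'rV[R]_n) : R :=
  ln (1 + enorm (x - y) / Num.min (bdist G x) (bdist G y)).

Definition jball (R : realType) (n : nat) (G : set 'rV[R]_n) (x : 'rV[R]_n)
    (M : R) : set 'rV[R]_n :=
  [set y | G y /\ jmetric G x y < M].

Definition ray (R : realType) (n : nat) (x v : 'rV[R]_n) : set 'rV[R]_n :=
  [set x + t *: v | t in [set t : R | 0 <= t]].

Definition bounded_domain (R : realType) (n : nat) (D : set 'rV[R]_n) : Prop :=
  [/\ D !=set0, open D, connected D & [bounded enorm y | y in D]].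

Definition strictly_starlike (R : realType) (n : nat) (D : set 'rV[R]_n)
    (x : 'rV[R]_n) : Prop :=
  [/\ bounded_domain D, D x &
      forall v : 'rV[R]_n, v != 0 -> exists! z, (ray x v `&` boundary D) z].

(* Main.v *)
Require Import Defs.
From HB Require Import structures.
From mathcomp Require Import all_boot all_order all_algebra.
From mathcomp Require Import all_classical all_reals all_analysis.
From mathcomp Require Import ring lra.
Import Order.TTheory GRing.Theory Num.Theory.
Import numFieldNormedType.Exports.
Local Open Scope classical_set_scope.
Local Open Scope ring_scope.

(** Put [c = exp M - 1], so that [M <= log (1 + sqrt 2)] means [c ^ 2 <= 2].
    The boundary of the punctured space is the origin, hence [y] lies in the
    [j]-ball exactly when [|x - y|] is smaller than both [c |x|] and [c |y|],
    that is, when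
      [slack c x y = c ^ 2 min (|x| ^ 2, |y| ^ 2) - |x - y| ^ 2]
    is positive ([jball_punctured]).  The slack is continuous in [y], so a
    boundary point of the ball is a zero of the slack that is a limit of points
    of the ball ([boundary_slack]).

    Along the ray [x + t v], the condition [|x - y| <= c |x|] reads
    [t ^ 2 |v| ^ 2 <= c ^ 2 |x| ^ 2], and the condition [|x - y| <= c |y|]
    reads [f t >= 0] with
      [f t = (c ^ 2 - 1) |v| ^ 2 t ^ 2 + 2 c ^ 2 (x . v) t + c ^ 2 |x| ^ 2].
    For positive [t], the quotient [f t / t] decreases as long as
    [(c ^ 2 - 1) t ^ 2 |v| ^ 2 <= c ^ 2 |x| ^ 2].  If [c ^ 2 <= 2], this covers
    the whole range allowed by the first condition, whatever the direction [v]
    is.  So a nonnegative slack at time [t] forces a positive slack at every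
    earlier time ([slack_ray_gt0]): the slack has a single zero on the ray, that
    zero is a limit of points of the ball, and the ball is a union of segments
    issued from [x], hence connected ([slack_starlike]).

    If [c ^ 2 > 2], the set [|x - y| < c |y|] is the exterior of a ball, and
    some ray from [x] is tangent to that ball before it leaves the ball
    [|x - y| < c |x|].  The tangency point and the exit point are two boundary
    points on the same ray ([slack_not_starlike]). *)

(** * Euclidean inner product *)

Definition dot {R : realType} {n : nat} (u v : 'rV[R]_n) : R :=
  \sum_(i < n) u ord0 i * v ord0 i.

Lemma enormE {R : realType} {n : nat} (v : 'rV[R]_n) :
  enorm v = Num.sqrt (dot v v).
Proof. by rewrite /enorm /dot; under eq_bigr do rewrite expr2. Qed.

Lemma dotvv_ge0 {R : realType} {n : nat} (v : 'rV[R]_n) : 0 <= dot v v.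
Proof. by apply: sumr_ge0 => i _; rewrite -expr2 sqr_ge0. Qed.

Lemma dotvv_gt0 {R : realType} {n : nat} (v : 'rV[R]_n) :
  (0 < dot v v) = (v != 0).
Proof.
rewrite lt0r dotvv_ge0 andbT; congr (~~ _); apply/idP/eqP => [|->].
  rewrite psumr_eq0 => [/allP v0|i _]; last by rewrite -expr2 sqr_ge0.
  apply/rowP => i; rewrite mxE; apply/eqP.
  by have := v0 i (mem_index_enum i); rewrite mulf_eq0 orbb.
by rewrite /dot big1 // => i _; rewrite mxE mul0r.
Qed.

Lemma enorm_sqr {R : realType} {n : nat} (v : 'rV[R]_n) :
  enorm v ^+ 2 = dot v v.
Proof. by rewrite enormE sqr_sqrtr // dotvv_ge0. Qed.

Lemma enorm_ge0 {R : realType} {n : nat} (v : 'rV[R]_n) : 0 <= enorm v.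
Proof. by rewrite enormE sqrtr_ge0. Qed.

Lemma enorm_gt0 {R : realType} {n : nat} (v : 'rV[R]_n) :
  (0 < enorm v) = (v != 0).
Proof. by rewrite enormE sqrtr_gt0 dotvv_gt0. Qed.

Lemma dot_lincomb {R : realType} {n : nat} (s t : R) (u v : 'rV[R]_n) :
  dot (s *: u + t *: v) (s *: u + t *: v) =
    s ^+ 2 * dot u u + 2 * s * t * dot u v + t ^+ 2 * dot v v.
Proof.
rewrite /dot !mulr_sumr -!big_split /=; apply: eq_bigr => i _.
by rewrite !mxE; ring.
Qed.

Lemma dotr_lincomb {R : realType} {n : nat} (s t : R) (u v : 'rV[R]_n) :
  dot u (s *: u + t *: v) = s * dot u u + t * dot u v.
Proof.
rewrite /dot !mulr_sumr -!big_split /=; apply: eq_bigr => i _.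
by rewrite !mxE; ring.
Qed.

Lemma dot_continuous {R : realType} {n : nat} :
  continuous (fun y : 'rV[R]_n => dot y y).
Proof.
move=> y; rewrite /continuous_at.
apply: cvg_big; [exact: add_continuous|exact: nbhs_filter|].
by move=> i _; apply: cvgM; [exact: nbhs_filter|exact: coord_continuous..].
Qed.

(** Some coordinate [x_i] is nonzero; projecting [x] to the plane of the
    coordinates [i] and [j], for any other [j], turning the projection by a right
    angle there and rescaling it gives [w]. *)
Lemma exists_orthogonal {R : realType} {n : nat} (x : 'rV[R]_n) :
  (2 <= n)%N -> x != 0 -> exists w, dot x w = 0 /\ dot w w = dot x x.
Proof.
move=> n2 x0.
have [w [xw w0]] : exists w, dot x w = 0 /\ w != 0.
  have /rV0Pn[i xi] := x0.
  have [j ji] : exists j : 'I_n, j != i.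
    have : (0 < #|predC1 i|)%N.
      by rewrite cardC1 card_ord; case: n n2 {x x0 i xi} => [|[]].
    by move/card_gt0P => [j]; rewrite inE; exists j.
  exists (x ord0 j *: delta_mx ord0 i - x ord0 i *: delta_mx ord0 j); split.
    rewrite /dot (bigD1 i) //= (bigD1 j) //= big1 => [|k /andP[ki kj]].
      by rewrite !mxE !eqxx (negPf ji) eq_sym (negPf ji) /=; ring.
    by rewrite !mxE (negPf ki) (negPf kj) /=; ring.
  apply/rV0Pn; exists j; rewrite !mxE !eqxx (negPf ji) /=.
  by rewrite mulr0 mulr1 sub0r oppr_eq0.
exists ((enorm x / enorm w) *: w); split.
  rewrite -[_ *: w]add0r -(scale0r x) dotr_lincomb xw; ring.
rewrite -[_ *: w]add0r -(scale0r x) dot_lincomb -!enorm_sqr.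
have : enorm w != 0 by rewrite gt_eqF // enorm_gt0.
by move=> ?; field.
Qed.

Lemma line_continuous {R : realType} {n : nat} (x v : 'rV[R]_n) :
  continuous (fun t : R => x + t *: v).
Proof.
by move=> t; apply: cvgD; [exact: cvg_cst|exact: scalel_continuous].
Qed.

(** One-sided, since the points of a starlike set on a ray all come before the
    exit point. *)
Lemma closure_line {R : realType} {n : nat} (D : set 'rV[R]_n)
    (x v : 'rV[R]_n) (r t : R) :
  r < t -> (forall s, r < s < t -> D (x + s *: v)) -> closure D (x + t *: v).
Proof.
move=> rt rtD B /line_continuous /nbhs_ballP[e /= e0 eB].
exists (x + Num.max ((r + t) / 2) (t - e / 2) *: v); split.
  by apply: rtD; rewrite lt_max gt_max; apply/andP; split; [apply/orP; left|];
    lra.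
apply: eB; rewrite /ball /= ger0_norm ?subr_ge0 ?ge_max; last lra.
by rewrite ltrBlDr -ltrBlDl lt_max; apply/orP; right; lra.
Qed.

(** * The j-ball of the punctured space *)

(** A nonzero [x] rules out dimension zero, where the punctured space is empty;
    it also gives a line of nonzero points that tends to the origin. *)
Lemma boundary_punctured {R : realType} {n : nat} (x : 'rV[R]_n) :
  x != 0 -> boundary [set~ (0 : 'rV[R]_n)] = [set 0].
Proof.
move=> x0.
have oG : open [set~ (0 : 'rV[R]_n)].
  apply: closed_openC; apply: accessible_closed_set1.
  by apply: hausdorff_accessible; exact: norm_hausdorff.
rewrite /boundary; have /interior_id -> := oG.
apply/seteqP; split => [y /= [_ /contrapT]//|_ ->] /=; split; last by [].
rewrite -[X in closure _ X](_ : 0 + 0 *: x = 0); last by rewrite scale0r addr0.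
apply: (@closure_line _ _ _ _ _ (-1)) => [|s /andP[_ s0]]; first lra.
by move/eqP; rewrite add0r scaler_eq0 (negPf x0) orbF lt_eqF.
Qed.

Lemma bdist_punctured {R : realType} {n : nat} (x y : 'rV[R]_n) :
  x != 0 -> bdist [set~ (0 : 'rV[R]_n)] y = enorm y.
Proof.
by move=> x0; rewrite /bdist (boundary_punctured x x0) image_set1 subr0 inf1.
Qed.

(** The squares make the slack a minimum of two polynomials in [y]; on a ray
    both are quadratic in the time. *)
Definition slack {R : realType} {n : nat} (c : R) (x y : 'rV[R]_n) : R :=
  c ^+ 2 * Num.min (dot x x) (dot y y) - dot (x - y) (x - y).

Lemma jball_punctured {R : realType} {n : nat} (x : 'rV[R]_n) (M : R) :
  x != 0 -> 0 < M ->
  jball [set~ (0 : 'rV[R]_n)] x M = [set y | 0 < slack (expR M - 1) x y].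
Proof.
move=> x0 M0; set c := expR M - 1.
have c0 : 0 < c by rewrite subr_gt0 expR_gt1.
apply/seteqP.
suff ballE (y : 'rV[R]_n) : y != 0 ->
    (jmetric [set~ (0 : 'rV[R]_n)] x y < M) = (0 < slack c x y).
  split=> y => [[/eqP y0]|sl]; first by rewrite ballE.
  have y0 : y != 0; last by split; [exact/eqP|rewrite ballE].
  move: sl; rewrite /mkset.
  apply: contraTneq => ->; rewrite /slack subr0 -leNgt subr_le0.
  have -> : dot (0 : 'rV[R]_n) 0 = 0.
    by rewrite /dot big1 // => i; rewrite mxE mul0r.
  by rewrite min_r ?dotvv_ge0 // mulr0 dotvv_ge0.
move=> y0; rewrite /jmetric !(bdist_punctured x _ x0).
have m0 : 0 < Num.min (enorm x) (enorm y) by rewrite lt_min !enorm_gt0 x0.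
rewrite -ltr_expR lnK; last first.
  by rewrite posrE ltr_pwDl // divr_ge0 ?enorm_ge0 // ltW.
rewrite -ltrBrDl -/c ltr_pdivrMr // /slack subr_gt0.
rewrite !minr_pMr ?(ltW c0) ?sqr_ge0 // !lt_min -!enorm_sqr -!exprMn.
by rewrite !ltr_sqr ?nnegrE ?mulr_ge0 ?enorm_ge0 // ltW.
Qed.

Lemma slack_continuous {R : realType} {n : nat} (c : R) (x : 'rV[R]_n) :
  continuous (slack c x).
Proof.
move=> y; apply: (@continuousB R R^o _
  (fun y => c ^+ 2 * Num.min (dot x x) (dot y y))
  (fun y => dot (x - y) (x - y))).
  apply: (@continuousM R _ (cst (c ^+ 2))); first exact: cst_continuous.
  apply: (@continuous_min R _ (cst (dot x x)) (fun y => dot y y)).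
    exact: cst_continuous.
  exact: dot_continuous.
apply: (@continuous_comp _ _ _ (fun y : 'rV[R]_n => x - y)
  (fun z : 'rV[R]_n => dot z z) y); last exact: dot_continuous.
apply: (@continuousB R 'rV[R]_n _ (cst x) id); first exact: cst_continuous.
by move=> A.
Qed.

Lemma open_slack {R : realType} {n : nat} (c : R) (x : 'rV[R]_n) :
  open [set y | 0 < slack c x y].
Proof.
apply: (@open_comp _ _ (slack c x) [set r | 0 < r]) => [y _|].
  exact: slack_continuous.
exact: open_gt.
Qed.

Lemma boundary_slack {R : realType} {n : nat} (c : R) (x y : 'rV[R]_n) :
  boundary [set y | 0 < slack c x y] y <->
  closure [set y | 0 < slack c x y] y /\ slack c x y = 0.
Proof.
rewrite /boundary; have /interior_id -> := open_slack c x.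
split => [[cy /negP]|[cy s0]]; last by split => //; rewrite /= s0 ltxx.
rewrite -leNgt => s0; split => //; apply/eqP; rewrite eq_le s0 /=.
have : closed [set y | 0 <= slack c x y].
  apply: (@preimage_closed _ _ (slack c x) [set r | 0 <= r]) => [z _|].
    exact: slack_continuous.
  exact: closed_ge.
by apply; apply: closureS cy => z /ltW.
Qed.

(** * The slack along a ray *)

Lemma slack_ray {R : realType} {n : nat} (c t : R) (x v : 'rV[R]_n) :
  slack c x (x + t *: v) =
  c ^+ 2 * Num.min (dot x x)
    (dot x x + 2 * t * dot x v + t ^+ 2 * dot v v) - t ^+ 2 * dot v v.
Proof.
rewrite /slack -[in X in Num.min _ X](scale1r x) dot_lincomb.
rewrite (_ : x - _ = 0 *: x + (- t) *: v); last first.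
  by rewrite scale0r add0r opprD addNKr scaleNr.
by rewrite dot_lincomb; congr (_ * Num.min _ _ - _); ring.
Qed.

(** With [f] the quadratic polynomial of the condition [|x - y| <= c |y|] on the
    ray, one has
      [t f s - s f t = (t - s) (c ^ 2 |x| ^ 2 - (c ^ 2 - 1) s t |v| ^ 2)],
    and the right-hand side is positive because [c ^ 2 - 1 <= 1] and
    [s t |v| ^ 2 < t ^ 2 |v| ^ 2 <= c ^ 2 |x| ^ 2].  Thus [f t >= 0] gives
    [f s > 0], although [f] need not be monotone. *)
Lemma slack_ray_gt0 {R : realType} {n : nat} (c s t : R) (x v : 'rV[R]_n) :
  0 < c -> c ^+ 2 <= 2 -> x != 0 -> v != 0 -> 0 <= s -> s < t ->
  0 <= slack c x (x + t *: v) -> 0 < slack c x (x + s *: v).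
Proof.
rewrite -!dotvv_gt0 !slack_ray => c0 c2 a0 V0 s0 st.
move: (dot x x) (dot x v) (dot v v) a0 V0 => a b V a0 V0.
rewrite subr_ge0 subr_gt0 !minr_pMr ?sqr_ge0 // le_min lt_min => /andP[tB tA].
have t0 : 0 < t by apply: le_lt_trans st.
have stV : s * t * V < t ^+ 2 * V.
  by rewrite ltr_pM2r // expr2 ltr_pM2r.
have ssV : s ^+ 2 * V <= s * t * V.
  by rewrite ler_pM2r // expr2 ler_wpM2l // ltW.
apply/andP; split; first lra.
have c1 : (c ^+ 2 - 1) * (s * t * V) <= s * t * V.
  by rewrite -[leRHS]mul1r ler_wpM2r ?mulr_ge0 ?(ltW t0) ?(ltW V0) //; lra.
have ca : 0 < (t - s) * (c ^+ 2 * a - (c ^+ 2 - 1) * (s * t * V)).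
  rewrite mulr_gt0 //; lra.
rewrite -subr_gt0 -(pmulr_rgt0 _ t0).
have tA' : 0 <= s * (c ^+ 2 * (a + 2 * t * b + t ^+ 2 * V) - t ^+ 2 * V).
  by rewrite mulr_ge0 // subr_ge0.
apply: lt_le_trans ca _; rewrite -subr_ge0; apply: le_trans tA' _.
by rewrite le_eqVlt; apply/orP; left; apply/eqP; ring.
Qed.

Lemma slack_center_gt0 {R : realType} {n : nat} (c : R) (x : 'rV[R]_n) :
  0 < c -> x != 0 -> 0 < slack c x x.
Proof.
move=> c0 x0; rewrite -[X in slack c x X]addr0 -(scale0r x) slack_ray.
rewrite mulr0 expr0n !mul0r !addr0 minxx subr0.
by rewrite mulr_gt0 ?exprn_gt0 ?dotvv_gt0.
Qed.

(** * The two ranges of the radius *)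

Lemma slack_starlike {R : realType} {n : nat} (c : R) (x : 'rV[R]_n) :
  0 < c -> c ^+ 2 <= 2 -> x != 0 ->
  strictly_starlike [set y | 0 < slack c x y] x.
Proof.
move=> c0 c2 x0; set D := [set y | _].
have Dx : D x by apply: slack_center_gt0.
split => //; first split.
- by exists x.
- exact: open_slack.
- have -> : D = \bigcup_(y in D) ((fun s => x + s *: (y - x)) @` `[0, 1]).
    apply/seteqP; split => [y Dy|z [y Dy [s /=]]].
      exists y => //; exists 1; first by rewrite /= in_itv /= ler01 lexx.
      by rewrite scale1r addrC subrK.
    rewrite in_itv /= => /andP[s0 s1] <-.
    have yE : y = x + 1 *: (y - x) by rewrite scale1r addrC subrK.
    have [->|yx] := eqVneq y x; first by rewrite subrr scaler0 addr0.
    move: s1; rewrite le_eqVlt => /predU1P[->|s1]; first by rewrite -yE.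
    apply: (@slack_ray_gt0 _ _ c s 1) => //; first by rewrite subr_eq0.
    by rewrite -yE ltW.
  apply: bigcup_connected.
    exists x => y _; exists 0; last by rewrite scale0r addr0.
    by rewrite /= in_itv /= ler01 lexx.
  move=> y _; apply: connected_continuous_connected.
    exact: segment_connected.
  by apply: continuous_subspaceT; exact: line_continuous.
- exists (Num.sqrt ((2 + 2 * c ^+ 2) * dot x x)); split; first exact: num_real.
  move=> K KK y Dy; apply: le_trans (ltW KK) => /=.
  rewrite ger0_norm ?enorm_ge0 // enormE ler_wsqrtr //.
  move: Dy; rewrite /D /= /slack minr_pMr ?sqr_ge0 // subr_gt0 lt_min.
  move=> /andP[Dy _].
  (* Parallelogram identity: |y|^2 + |2 x - y|^2 = 2 |x|^2 + 2 |x - y|^2. *)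
  have := dot_lincomb 1 (-1) x y; rewrite scale1r scaleN1r => dxy.
  have := dotvv_ge0 (2 *: x + (-1) *: y); rewrite dot_lincomb.
  by move: Dy; rewrite dxy; lra.
move=> v v0.
(* At time T the ray leaves the ball of radius c |x| around x, so the slack
   vanishes somewhere in between by the intermediate value theorem. *)
pose T := Num.sqrt (c ^+ 2 * dot x x / dot v v).
have [t] : exists2 t, t \in `[0, T] & slack c x (x + t *: v) = 0.
  apply: (@IVT _ (fun t => slack c x (x + t *: v))); first exact: sqrtr_ge0.
    apply: continuous_subspaceT => t.
    apply: (@continuous_comp _ _ _ (fun t : R => x + t *: v) (slack c x)).
      exact: line_continuous.
    exact: slack_continuous.
  have f0 : 0 < slack c x (x + 0 *: v).
    by rewrite scale0r addr0 slack_center_gt0.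
  have fT : slack c x (x + T *: v) <= 0.
    rewrite slack_ray subr_le0 sqr_sqrtr; last first.
      by rewrite divr_ge0 ?dotvv_ge0 // mulr_ge0 ?dotvv_ge0 ?sqr_ge0.
    rewrite [leRHS]divfK ?gt_eqF ?dotvv_gt0 //.
    by rewrite ler_wpM2l ?sqr_ge0 // ge_min lexx.
  by rewrite ge_min le_max fT (ltW f0) orbT.
rewrite in_itv /= => /andP[t0 _] ft.
have tpos : 0 < t.
  rewrite lt_neqAle t0 andbT; apply: contra_eqN ft => /eqP <-.
  by rewrite scale0r addr0 gt_eqF // slack_center_gt0.
exists (x + t *: v); split.
  split; first by exists t.
  apply/boundary_slack; split => //.
  apply: (@closure_line _ _ _ _ _ 0) => // s /andP[s0 st].
  by apply: (@slack_ray_gt0 _ _ c _ t) => //; rewrite ?ft // ltW.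
move=> _ [[s /= s0 <-]] /boundary_slack[_ fs].
have [st|ts|->//] := ltgtP s t.
  have := @slack_ray_gt0 _ _ c s t x v c0 c2 x0 v0 s0 st.
  by rewrite fs ft lexx ltxx => /(_ isT).
have := @slack_ray_gt0 _ _ c t s x v c0 c2 x0 v0 t0 ts.
by rewrite fs ft lexx ltxx => /(_ isT).
Qed.

(** Take [w] orthogonal to [x] with [|w| = |x|], put [k = sqrt (c ^ 2 - 1) > 1]
    and [v = w - k x].  Then [|v| = c |x|], and the slack at [x + t v] is
    [c ^ 2 |x| ^ 2 min (1 - t ^ 2, (1 - t k) ^ 2)].  The second term has a double
    zero at [t = 1 / k < 1], where the ray touches the excluded ball, and the
    first one vanishes at [t = 1]; the slack is positive at all other times
    in [0, 1). *)
Lemma slack_not_starlike {R : realType} {n : nat} (c : R) (x : 'rV[R]_n) :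
  (2 <= n)%N -> 0 < c -> 2 < c ^+ 2 -> x != 0 ->
  ~ strictly_starlike [set y | 0 < slack c x y] x.
Proof.
move=> n2 c0 c2 x0 [_ _ one]; set D := [set y | _] in one.
have [w [xw ww]] := exists_orthogonal x n2 x0.
set k := Num.sqrt (c ^+ 2 - 1).
have k2 : c ^+ 2 = k ^+ 2 + 1 by rewrite sqr_sqrtr; lra.
have k1 : 1 < k by rewrite -[ltLHS]sqrtr1 ltr_sqrt; lra.
have a0 : 0 < dot x x by rewrite dotvv_gt0.
pose v := (- k) *: x + 1 *: w.
have vv : dot v v = c ^+ 2 * dot x x.
  by rewrite dot_lincomb xw ww k2; ring.
have xv : dot x v = - k * dot x x by rewrite dotr_lincomb xw; ring.
have v0 : v != 0 by rewrite -dotvv_gt0 vv mulr_gt0 ?exprn_gt0.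
have slackE t : slack c x (x + t *: v) =
    c ^+ 2 * dot x x * Num.min (1 - t ^+ 2) ((1 - t * k) ^+ 2).
  rewrite slack_ray vv xv minr_pMr ?sqr_ge0 // addr_minl.
  rewrite minr_pMr ?mulr_ge0 ?sqr_ge0 ?ltW //; congr Num.min; first ring.
  by rewrite k2; ring.
have kV : k^-1 < 1 by rewrite invf_lt1 //; lra.
have kV0 : 0 < k^-1 by rewrite invr_gt0; lra.
have bd r t : 0 <= r -> r < t -> t <= 1 ->
    (forall s, r < s < t -> s * k != 1) -> slack c x (x + t *: v) = 0 ->
    (ray x v `&` boundary D) (x + t *: v).
  move=> r0 rt t1 sk st; split; first by exists t => //=; lra.
  apply/boundary_slack; split => //.
  apply: (@closure_line _ _ _ _ _ r) => // s srt.
  rewrite /D /= slackE mulr_gt0 ?mulr_gt0 ?exprn_gt0 // lt_min subr_gt0.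
  rewrite exprn_even_gt0 //= subr_eq0 eq_sym sk // andbT.
  by move: srt => /andP[rs st']; rewrite expr_lt1 //; lra.
have [z [_ uz]] := one v v0.
have z1 : z = x + k^-1 *: v.
  apply: uz; apply: (bd 0) => // [|s /andP[_ sk]|]; first exact: ltW.
    by rewrite lt_eqF // -ltr_pdivlMr ?div1r //; lra.
  rewrite slackE mulVf ?gt_eqF //; last lra.
  rewrite subrr expr0n /= min_r ?mulr0 //.
  by rewrite subr_ge0 expr_le1 // ltW.
have z2 : z = x + 1 *: v.
  apply: uz; apply: (bd k^-1) => // [|s /andP[sk _]|]; first exact: ltW.
    by rewrite gt_eqF // -ltr_pdivrMr ?div1r //; lra.
  by rewrite slackE expr1n subrr min_l ?mulr0 // sqr_ge0.
have /eqP : k^-1 *: v = 1 *: v by apply: (addrI x); rewrite -z1.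
by rewrite -subr_eq0 -scalerBl scaler_eq0 (negPf v0) orbF subr_eq0 lt_eqF.
Qed.

Theorem theorem3p4 (R : realType) (n : nat) (hn : (2 <= n)%N)
    (x : 'rV[R]_n) (hx : [set~ (0 : 'rV[R]_n)] x) (M : R) (hM : 0 < M) :
  strictly_starlike (jball [set~ (0 : 'rV[R]_n)] x M) x <->
  M \in `]0, ln (1 + Num.sqrt 2)].
Proof.
have x0 : x != 0 by apply/eqP.
have c0 : 0 < expR M - 1 by rewrite subr_gt0 expR_gt1.
rewrite jball_punctured // in_itv /= hM /=.
have s2 : 0 <= Num.sqrt (2 : R) := sqrtr_ge0 _.
rewrite -ler_expR lnK ?posrE; last by lra.
rewrite -lerBlDl -(ler_sqr (ltW c0) s2) sqr_sqrtr //.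
split=> [|c2]; last exact: slack_starlike.
by rewrite leNgt => st; apply/negP => c2; exact: slack_not_starlike st.
Qed.
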